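(* Let $q>0$ and let $f^t$ be a time-dependent family of mean-zero functions in $L^2(\mathbb{T}^d)$ with $\|f^t\|_{\dot H^{-q}}>0$ for all $t>0$. For any positive function $h(t)$ such that $h(t)=o\big(\|f^t\|_{\dot H^{-q}}\big)$ as $t\to\infty$, there is a function $g\in\dot H^{q}$ such that $$\limsup_{t\to\infty}\frac{|\langle f^t,g\rangle|}{h(t)}>0 .$$
   Context: $\mathbb{T}^d$ is the $d$-dimensional torus (period $1$ in each coordinate). Time $t$ ranges over $[0,\infty)$ or over the nonnegative integers, and for each $t$ the function $f^t=f(t,\cdot)$ is given; no evolution equation is imposed. Fourier coefficients: $f_{\mathbf{k}}=\int_{\mathbb{T}^d} f(\mathbf{x})e^{-2\pi i\,\mathbf{x}\cdot\mathbf{k}}\,d\mathbf{x}$ for $\mathbf{k}\in\mathbb{Z}^d$, and $k=|\mathbf{k}|$ denotes the Euclidean norm. Mean-zero means $f_{\mathbf{0}}=0$. For $\alpha\in\mathbb{R}$, $\|f\|_{\dot H^{\alpha}}=\big(\sum_{\mathbf{k}\neq \mathbf{0}}k^{2\alpha}|f_{\mathbf{k}}|^2\big)^{1/2}$, and $\dot H^\alpha$ is the space of mean-zero $f$ on $\mathbb{T}^d$ for which this is finite. The pairing is $\langle f,g\rangle=\sum_{\mathbf{k}}f_{\mathbf{k}}\overline{g_{\mathbf{k}}}$ (the $L^2$ inner product). *)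

(* Defs.v *)
From HB Require Import structures.
From mathcomp Require Import all_boot all_order all_algebra.
From mathcomp Require Import all_classical all_reals all_analysis.
From mathcomp Require Import complex.

Set Implicit Arguments.
Unset Strict Implicit.
Unset Printing Implicit Defensive.

Import Order.TTheory GRing.Theory Num.Theory.
Import numFieldNormedType.Exports.

Local Open Scope classical_set_scope.
Local Open Scope ring_scope.
Local Open Scope complex_scope.

(* Lets the Landau notations be used at infinity. *)
Canonical pinfty_filter_on (R : numFieldType) :=
  FilterType (pinfty_nbhs R) proper_pinfty_nbhs.

(* R^d, with the product of the Borel sigma-algebras. *)
Notation Rvec R d := (d.-tuple (measurableTypeR R)).

(* Lebesgue measure on R^d, by recursion on d: on R^(n+1) it is the image of the
   product of Lebesgue measure on R and on R^n under (a, x) |-> a :: x. *)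
Section LebesgueVec.
Context {R : realType}.

Definition consvec n (p : measurableTypeR R * Rvec R n) : Rvec R n.+1 :=
  [tuple of p.1 :: p.2].

Lemma measurable_consvec n :
  measurable_fun [set: measurableTypeR R * Rvec R n] (@consvec n).
Proof.
by apply: measurable_cons; [exact: measurable_fst|exact: measurable_snd].
Qed.

Section Step.
Context (n : nat) (mu : {sigma_finite_measure set (Rvec R n) -> \bar R}).

Definition lebesgue_cons : set (Rvec R n.+1) -> \bar R :=
  pushforward (@lebesgue_measure R \x mu)%E (@consvec n).

Let lebesgue_cons0 : lebesgue_cons set0 = 0%E.
Proof. by rewrite /lebesgue_cons /pushforward preimage_set0 measure0. Qed.

Let lebesgue_cons_ge0 A : (0 <= lebesgue_cons A)%E.
Proof. exact: (measure_ge0 (@lebesgue_measure R \x mu)%E). Qed.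

Let lebesgue_cons_sigma_additive : semi_sigma_additive lebesgue_cons.
Proof.
move=> F mF tF mUF; rewrite /lebesgue_cons /pushforward preimage_bigcup.
have mp A : measurable A -> measurable (@consvec n @^-1` A).
  by move=> mA; rewrite -[X in measurable X]setTI; exact: measurable_consvec.
apply: measure_semi_sigma_additive.
- by move=> i; exact: mp.
- apply/trivIsetP => /= i j _ _ ij; rewrite -preimage_setI.
  by move/trivIsetP : tF => /(_ _ _ _ _ ij) ->//; rewrite preimage_set0.
- by rewrite -preimage_bigcup; exact: mp.
Qed.

HB.instance Definition _ := isMeasure.Build _ _ _ lebesgue_cons
  lebesgue_cons0 lebesgue_cons_ge0 lebesgue_cons_sigma_additive.

Let lebesgue_cons_sigma_finite : sigma_finite [set: Rvec R n.+1] lebesgue_cons.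
Proof.
have /sigma_finiteP[F [TF ndF Foo]] := sigma_finiteT (@lebesgue_measure R).
have /sigma_finiteP[G [TG ndG Goo]] := sigma_finiteT mu.
pose uncons (x : Rvec R n.+1) : measurableTypeR R * Rvec R n :=
  (tnth x ord0, [tuple of behead x]).
have munc : measurable_fun [set: Rvec R n.+1] uncons.
  apply/measurable_fun_pairP; split.
    exact: measurable_tnth.
  exact: measurable_behead.
have uncK p : uncons (consvec p) = p.
  by case: p => a x; congr pair; exact/val_inj.
exists (fun i => uncons @^-1` (F i `*` G i)).
  apply/seteqP; split=> // x _.
  have [i _ Fi] : (\bigcup_i F i) (uncons x).1 by rewrite -TF.
  have [j _ Gj] : (\bigcup_i G i) (uncons x).2 by rewrite -TG.
  exists (maxn i j) => //; split.
  - by move: Fi; exact/subsetPset/ndF/leq_maxl.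
  - by move: Gj; exact/subsetPset/ndG/leq_maxr.
move=> i; have [mF Fi] := Foo i; have [mG Gi] := Goo i; split.
  by rewrite -[X in measurable X]setTI; apply: munc => //; exact: measurableX.
rewrite /lebesgue_cons /pushforward -comp_preimage.
rewrite (_ : uncons \o _ = id); last by apply/funext => p /=; exact: uncK.
by rewrite product_measure1E// lte_mul_pinfty// ge0_fin_numE.
Qed.

HB.instance Definition _ := Measure_isSigmaFinite.Build _ _ _ lebesgue_cons
  lebesgue_cons_sigma_finite.

End Step.

Fixpoint lebesgue_vec (d : nat) :
    {sigma_finite_measure set (Rvec R d) -> \bar R} :=
  match d with
  | 0 => \d_([tuple] : Rvec R 0)
  | n.+1 => lebesgue_cons (lebesgue_vec n)
  end.

End LebesgueVec.
Arguments lebesgue_vec R d : clear implicits.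

Section Torus.
Context {R : realType} {d : nat}.
Implicit Types (f g : Rvec R d -> R[i]) (k : d.-tuple int).

Definition unit_cube : set (Rvec R d) :=
  [set x | forall i, 0 <= (tnth x i : R) < 1].

(* A function on the torus is a function on R^d of period 1 in each coordinate. *)
Definition torus_periodic f : Prop :=
  forall (x : Rvec R d) (m : d.-tuple int),
    f [tuple (tnth x i : R) + (tnth m i)%:~R | i < d] = f x.

Definition L2_torus f : Prop :=
  [/\ torus_periodic f,
      measurable_fun [set: Rvec R d] (fun x => complex.Re (f x) : measurableTypeR R),
      measurable_fun [set: Rvec R d] (fun x => complex.Im (f x) : measurableTypeR R) &
      (\int[lebesgue_vec R d]_(x in unit_cube) (Normc.normc (f x) ^+ 2)%:E < +oo)%E].

Definition integral_torus f : R[i] :=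
  (\int[lebesgue_vec R d]_(x in unit_cube) complex.Re (f x))
  +i* (\int[lebesgue_vec R d]_(x in unit_cube) complex.Im (f x)).

Definition expi (a : R) : R[i] := cos a +i* sin a.

Definition dot (x : Rvec R d) k : R := \sum_(i < d) (tnth x i : R) * (tnth k i)%:~R.

Definition fourier f k : R[i] :=
  integral_torus (fun x => f x * expi (- (2 * pi * dot x k))).

Definition freq0 : d.-tuple int := [tuple 0 | _ < d].

Definition enorm k : R := Num.sqrt (\sum_(i < d) (tnth k i)%:~R ^+ 2).

Definition mean_zero f : Prop := fourier f freq0 = 0.

(* Extended-real valued, so that finiteness is expressed by < +oo. *)
Definition Hnorm (a : R) f : \bar R :=
  ((\esum_(k in [set k | k != freq0])
      (enorm k `^ (2 * a) * Normc.normc (fourier f k) ^+ 2)%:E) `^ 2^-1)%E.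

(* Intended for a >= 0, where the elements of H^a are genuine square-integrable
   functions; negative exponents only occur through Hnorm. *)
Definition Hdot (a : R) g : Prop :=
  [/\ L2_torus g, mean_zero g & (Hnorm a g < +oo)%E].

(* Unordered sum over Z^d; meaningful for absolutely summable families, which
   the products fourier f k * (fourier g k)^* are when f and g are in L^2. *)
Definition rsum (u : d.-tuple int -> R) : R :=
  fine (\esum_(k in [set: d.-tuple int]) (u^\+ k)%:E)
  - fine (\esum_(k in [set: d.-tuple int]) (u^\- k)%:E).

Definition csum (u : d.-tuple int -> R[i]) : R[i] :=
  rsum (fun k => complex.Re (u k)) +i* rsum (fun k => complex.Im (u k)).

Definition pairing f g : R[i] :=
  csum (fun k => fourier f k * (fourier g k)^*).

End Torus.

(* Main.v *)
(* Otherwise the functionals g |-> <f^t, g> / h(t) on H^q would tend to 0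
   pointwise although their norms ||f^t||_{H^-q} / h(t) tend to infinity, against
   the uniform boundedness principle.  The principle is run by hand, as a gliding
   hump (following Sokal's short proof): choose times s_j -> oo with
   h(s_j) <= 8^-j L_j, where L_j is the H^-q norm of f^{s_j}, and trigonometric
   polynomials p_j of H^q norm at most 1 on which the j-th functional is at least
   L_j / 2.  In g = \sum_j e_j 8^-j p_j the signs e_j are chosen successively so
   that the terms before the j-th one do not cancel it, while the terms after it
   contribute at most 8^-j L_j / 7; hence |<f^{s_j}, g>| >= 8^-j L_j / 4 >= h(s_j) / 4.

   Using only the real or only the imaginary part of the coefficients of f^{s_j}
   costs a factor 2 in the square of the norm and makes all the coefficients of g
   real.  That g is a genuine L^2 function with the expected Fourier coefficients
   is Riesz-Fischer for a geometrically convergent series: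
   \sum_j 8^-j |p_j(x)|^2 is integrable, so it is finite almost everywhere and
   bounds the square of the partial sums of g. *)

Require Import Defs.
From mathcomp Require Import all_boot all_order all_algebra.
From mathcomp Require Import finmap.
From mathcomp Require Import all_classical all_reals all_analysis.
From mathcomp Require Import measurable_realfun.
From mathcomp Require Import complex.
From mathcomp Require Import ring lra.

Set Implicit Arguments.
Unset Strict Implicit.
Unset Printing Implicit Defensive.

Import Order.TTheory GRing.Theory Num.Theory.
Import numFieldNormedType.Exports.

Local Open Scope classical_set_scope.
Local Open Scope ring_scope.
Local Open Scope complex_scope.

(** * Finite sums and unordered sums *)

Section FiniteSums.
Context {R : realType} {K : choiceType}.
Implicit Types (u v w : K -> R) (F : {fset K}).

Lemma le_fset_sum_nneg u F F' : (forall k, 0 <= u k) -> (F `<=` F')%fset ->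
  \sum_(k <- F) u k <= \sum_(k <- F') u k.
Proof.
move=> u0 /fsubsetP FF'.
rewrite [leRHS](bigID (mem F))/= -[X in X <= _]addr0 lerD ?sumr_ge0//.
rewrite -[in leRHS]big_filter le_eqVlt; apply/orP; left; apply/eqP.
apply: perm_big; rewrite uniq_perm ?filter_uniq ?fset_uniq// => k.
rewrite mem_filter; apply/idP/andP => [kF|[]//].
by split=> //; exact: FF'.
Qed.

Lemma fset_sum_le_esum u F (D : set K) : [set` F] `<=` D ->
  ((\sum_(k <- F) u k)%:E <= \esum_(k in D) (u k)%:E)%E.
Proof.
move=> FD; apply: esum_ge; exists [set` F]; first by split.
by rewrite fsbig_finite//= set_fsetK sumEFin.
Qed.

Lemma esum_le_fset_sum u (D : set K) (B : R) :
  (forall F, [set` F] `<=` D -> \sum_(k <- F) u k <= B) ->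
  (\esum_(k in D) (u k)%:E <= B%:E)%E.
Proof.
move=> uB; apply: ge_ereal_sup => /= _ [X [finX XD] <-].
rewrite fsbig_finite//= sumEFin lee_fin; apply: uB => k /=.
by rewrite in_fset_set// inE => /XD.
Qed.

Lemma esum_gt_fset_sum u (D : set K) (B : R) :
  (B%:E < \esum_(k in D) (u k)%:E)%E ->
  exists2 F : {fset K}, [set` F] `<=` D & B < \sum_(k <- F) u k.
Proof.
move=> /ereal_sup_gt[_ [X [finX XD] <-]]; rewrite fsbig_finite//= sumEFin lte_fin.
exists (fset_set X) => // k /=; by rewrite in_fset_set// inE => /XD.
Qed.

(** The estimate persists when [F] grows, so that the sets found for two families can be merged. The
    bound [B] makes the unordered sum finite, hence [fine] faithful. *)
Lemma fine_esum_approx u F0 (B e : R) : (forall k, 0 <= u k) ->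
  (forall F, \sum_(k <- F) u k <= B) -> 0 < e ->
  exists2 F : {fset K}, (F0 `<=` F)%fset & forall F', (F `<=` F')%fset ->
    `|fine (\esum_(k in [set: K]) (u k)%:E) - \sum_(k <- F') u k| <= e.
Proof.
move=> u0 uB e0; set s := esum _ _.
have sB : (s <= B%:E)%E by exact: esum_le_fset_sum.
have s0 : (0 <= s)%E by apply: esum_ge0 => k _; rewrite lee_fin.
have sfin : s \is a fin_num.
  by rewrite ge0_fin_numE// (le_lt_trans sB)// ltry.
have [F _ Fs] : exists2 F : {fset K}, [set` F] `<=` [set: K] & fine s - e < \sum_(k <- F) u k.
  apply: esum_gt_fset_sum; rewrite -/s -[ltRHS]fineK// lte_fin; lra.
exists (F `|` F0)%fset; first exact: fsubsetUr.
move=> F' FF'.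
have h1 : \sum_(k <- F) u k <= \sum_(k <- F') u k.
  by apply: le_fset_sum_nneg => //; exact: fsubset_trans (fsubsetUl _ _) FF'.
have h2 : \sum_(k <- F') u k <= fine s.
  by rewrite -lee_fin fineK//; exact: fset_sum_le_esum.
rewrite ler_norml; lra.
Qed.

End FiniteSums.

(** Positive and negative parts are approximated separately and their finite sets united.
    Prescribing [F0] lets a bound known only for large finite sets pass to the unordered sum. *)
Lemma rsum_approx (R : realType) (d : nat) (u : d.-tuple int -> R) (B e : R)
    (F0 : {fset d.-tuple int}) :
  (forall F : {fset d.-tuple int}, \sum_(k <- F) `|u k| <= B) -> 0 < e ->
  exists2 F : {fset d.-tuple int}, (F0 `<=` F)%fset &
    `|rsum u - \sum_(k <- F) u k| <= e.
Proof.
move=> uB e0; have e20 : 0 < e / 2 by lra.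
have pB (p : d.-tuple int -> R) : (forall k, p k <= `|u k|) ->
    forall F : {fset d.-tuple int}, \sum_(k <- F) p k <= B.
  by move=> pu F; apply: le_trans (uB F); apply: ler_sum.
have [||F1 F01 h1] := fine_esum_approx F0 _ (pB (u^\+) _) e20.
- by move=> k; rewrite funrpos_ge0.
- by move=> k; rewrite /funrpos ge_max normr_ge0 ler_norm.
have [||F2 F02 h2] := fine_esum_approx F0 _ (pB (u^\-) _) e20.
- by move=> k; rewrite funrneg_ge0.
- by move=> k; rewrite /funrneg ge_max normr_ge0 -normrN ler_norm.
exists (F1 `|` F2)%fset; first exact: fsubset_trans F01 (fsubsetUl _ _).
have {}h1 := h1 (F1 `|` F2)%fset (fsubsetUl _ _).
have {}h2 := h2 (F1 `|` F2)%fset (fsubsetUr _ _).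
have -> : \sum_(k <- (F1 `|` F2)%fset) u k =
   \sum_(k <- (F1 `|` F2)%fset) u^\+ k - \sum_(k <- (F1 `|` F2)%fset) u^\- k.
  by rewrite -sumrB; apply: eq_bigr => k _; rewrite -[in LHS](funrposBneg u).
rewrite /rsum; move: h1 h2; rewrite !ler_norml; lra.
Qed.

(** * The gliding hump *)

Section GeometricSeries.
Context {R : realType}.
Local Notation c := (8^-1 : R).

Lemma geometric_sum_le (m n : nat) : \sum_(m <= i < n) c ^+ i <= 8 / 7 * c ^+ m.
Proof.
have c0 i : 0 <= c ^+ i by rewrite exprn_ge0// invr_ge0.
have [nm|mn] := leqP n m; first by rewrite big_geq// mulr_ge0.
suff -> : \sum_(m <= i < n) c ^+ i = 8 / 7 * (c ^+ m - c ^+ n).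
  by rewrite ler_wpM2l// lerBlDr lerDl.
rewrite -(subnKC (ltnW mn)); elim: (n - m)%N => [|p IH].
  by rewrite addn0 big_geq// subrr mulr0.
by rewrite addnS big_nat_recr ?leq_addr//= IH exprS; field.
Qed.

Lemma is_cvg_geometric_combination (x : nat -> R) (M : R) :
  (forall i, `|x i| <= M) -> cvgn (fun n => \sum_(0 <= i < n) c ^+ i * x i).
Proof.
move=> xM.
have M0 : 0 <= M by exact: le_trans (xM 0%N).
apply: (@normed_cvg _ _ (fun i => c ^+ i * x i)).
apply: (@series_le_cvg _ _ (fun i => M * c ^+ i)).
- by move=> n; exact: normr_ge0.
- by move=> n; rewrite mulr_ge0// exprn_ge0// invr_ge0.
- move=> n /=; rewrite normrM ger0_norm ?exprn_ge0 ?invr_ge0// mulrC.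
  by rewrite ler_wpM2r// exprn_ge0 ?invr_ge0.
- apply: is_cvg_geometric_series.
  by rewrite ger0_norm ?invr_ge0// invf_lt1// ltr1n.
Qed.

(** Cauchy-Schwarz for the weights [8^-i], whose total mass 8/7 is rounded up to 2. *)
Lemma sqr_geometric_combination_le (x : nat -> R) (n : nat) :
  (\sum_(0 <= i < n) c ^+ i * x i) ^+ 2 <= 2 * \sum_(0 <= i < n) c ^+ i * x i ^+ 2.
Proof.
elim: n x => [|n IH] x; first by rewrite !big_geq// expr0n/= mulr0.
rewrite !big_nat_recl//= !expr0 !mul1r.
under eq_bigr do rewrite exprS -mulrA.
under [in leRHS]eq_bigr do rewrite exprS -mulrA.
rewrite -!mulr_sumr; have := IH (fun i => x i.+1).
move: (\sum_(0 <= i < n) _ * x i.+1) (\sum_(0 <= i < n) _ * x i.+1 ^+ 2) => s t st.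
(* The square is completed so as to leave the coefficient 1/8 on [s ^+ 2]: the induction hypothesis
   then yields [t / 4], exactly the share of [t] on the right. *)
apply: (@le_trans _ _ (8 / 7 * x 0%N ^+ 2 + s ^+ 2 / 8)).
  rewrite -subr_ge0 (_ : _ - _ = 7^-1 * (x 0%N - 7 / 8 * s) ^+ 2); last by field.
  by rewrite mulr_ge0 ?invr_ge0// sqr_ge0.
have := sqr_ge0 (x 0%N); lra.
Qed.

End GeometricSeries.

(** The sign [e j] aligns the diagonal term with the part of row [j] before it. That part involves
    only earlier signs, so the choice can be made recursively. *)
Lemma signs_no_cancellation (R : realType) (u : nat -> nat -> R) :
  exists2 e : nat -> R, forall i, `|e i| = 1 &
    forall j, `|u j j| <= `|\sum_(0 <= i < j.+1) e i * u j i|.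
Proof.
pose sgn (n : nat) (s : seq R) : R :=
  if 0 <= (\sum_(0 <= i < n) s`_i * u n i) * u n n then 1 else -1.
(* Each choice depends on all the earlier signs, so the recursion carries their whole list. *)
pose signs := fix signs n : seq R :=
  if n is n'.+1 then rcons (signs n') (sgn n' (signs n')) else [::].
have size_signs n : size (signs n) = n by elim: n => //= n IH; rewrite size_rcons IH.
pose e i := (signs i.+1)`_i.
have eE i : e i = sgn i (signs i).
  by rewrite /e/= nth_rcons size_signs ltnn eqxx.
have signsE n i : (i < n)%N -> (signs n)`_i = e i.
  elim: n => // n IH; rewrite ltnS leq_eqVlt => /predU1P[->//|lt_in].
  by rewrite /= nth_rcons size_signs lt_in IH.
exists e => [i|j].
  by rewrite eE /sgn; case: ifP; rewrite ?normrN normr1.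
rewrite big_nat_recr//= eE /sgn.
have -> : \sum_(0 <= i < j) (signs j)`_i * u j i = \sum_(0 <= i < j) e i * u j i.
  by apply: eq_big_nat => i /andP[_ ij]; rewrite signsE.
move: (\sum_(0 <= i < j) _) (u j j) => s t.
(* With the aligned sign the cross term of the square is nonnegative, so the square is at least
   [t ^+ 2]. *)
case: ifPn => [st|]; last first.
  rewrite -ltNge => st; rewrite mulN1r -ler_sqr ?nnegrE// !real_normK ?num_real//.
  have := sqr_ge0 s; nra.
rewrite mul1r -ler_sqr ?nnegrE// !real_normK ?num_real//.
have := sqr_ge0 s; nra.
Qed.

Section GlidingHump.
Context {R : realType} {K : choiceType}.
Implicit Types (F : {fset K}).
Local Notation c := (8^-1 : R).

Lemma cvg_seq_sum (I : Type) (r : seq I) (u : I -> nat -> R) (l : I -> R) :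
  (forall i, u i n @[n --> \oo] --> l i) ->
  (\sum_(i <- r) u i n) @[n --> \oo] --> \sum_(i <- r) l i.
Proof.
move=> ul; elim: r => [|i r IH].
  by rewrite big_nil; under eq_fun do rewrite big_nil; exact: cvg_cst.
by rewrite big_cons; under eq_fun do rewrite big_cons; exact: cvgD (ul i) IH.
Qed.

(** Termwise Young inequality balanced by [L]. For [B = 1] the bound is [L] itself, the usual dual
    norm estimate. *)
Lemma weighted_cauchy_schwarz (w x y : K -> R) F (L B : R) :
  (forall k, 0 < w k) -> 0 < L ->
  \sum_(k <- F) (x k / w k) ^+ 2 <= L ^+ 2 ->
  \sum_(k <- F) (w k * y k) ^+ 2 <= B ->
  \sum_(k <- F) `|x k * y k| <= L * ((1 + B) / 2).
Proof.
move=> w0 L0 xL yB.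
apply: (@le_trans _ _ (\sum_(k <- F)
   (((x k / w k) ^+ 2) / (2 * L) + L / 2 * (w k * y k) ^+ 2))).
  apply: ler_sum => k _.
  have wk := w0 k; have wn : w k != 0 by rewrite gt_eqF.
  have -> : x k * y k = (x k / w k) * (w k * y k) by field.
  move: (x k / w k) (w k * y k) => p r.
  rewrite normrM -subr_ge0.
  have -> : p ^+ 2 / (2 * L) + L / 2 * r ^+ 2 - `|p| * `|r| =
     (2 * L)^-1 * (`|p| - L * `|r|) ^+ 2.
    rewrite -(real_normK (num_real p)) -(real_normK (num_real r)).
    by field; rewrite gt_eqF.
  by rewrite mulr_ge0 ?invr_ge0 ?sqr_ge0// mulr_ge0// ltW.
rewrite big_split/= -mulr_suml -mulr_sumr.
have -> : L * ((1 + B) / 2) = L ^+ 2 / (2 * L) + L / 2 * B.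
  by field; rewrite gt_eqF.
apply: lerD; first by rewrite ler_wpM2r// invr_ge0 mulr_ge0// ltW.
by rewrite ler_wpM2l// divr_ge0// ltW.
Qed.

Lemma fset_sum_support (u : K -> R) F F' : (F `<=` F')%fset ->
  (forall k, k \notin F -> u k = 0) -> \sum_(k <- F') u k = \sum_(k <- F) u k.
Proof.
move=> /fsubsetP FF' u0; rewrite (bigID (mem F))/=.
rewrite [X in _ + X]big1 ?addr0; last by move=> k /u0.
rewrite -big_filter; apply: perm_big; rewrite uniq_perm ?filter_uniq ?fset_uniq//.
move=> k; rewrite mem_filter; apply/andP/idP => [[]//|kF].
by split=> //; exact: FF'.
Qed.

Section Combination.
Variables (w : K -> R) (a : nat -> K -> R).
Hypothesis w1 : forall k, 1 <= w k.
Hypothesis a1 : forall i F, \sum_(k <- F) (w k * a i k) ^+ 2 <= 1.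

Let gamma k := limn (fun n => \sum_(0 <= i < n) c ^+ i * a i k).

Lemma geometric_coefficient_le1 i k : `|a i k| <= 1.
Proof.
have := a1 i [fset k]%fset; rewrite big_seq_fset1 exprMn => h.
rewrite -[leRHS]normr1 -ler_sqr ?nnegrE// !real_normK ?num_real// expr1n.
apply: le_trans h; rewrite ler_peMl ?sqr_ge0//.
have := w1 k; nra.
Qed.

Lemma cvg_geometric_coefficient k :
  (\sum_(0 <= i < n) c ^+ i * a i k) @[n --> \oo] --> gamma k.
Proof.
apply: is_cvg_geometric_combination => i; exact: geometric_coefficient_le1.
Qed.

(** The bound 2 * 8/7, at most 3, holds uniformly for the partial combinations and passes to the
    limit because [F] is finite. *)
Lemma geometric_coefficient_sqr_le F : \sum_(k <- F) (w k * gamma k) ^+ 2 <= 3.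
Proof.
have cv : (\sum_(k <- F) (w k * \sum_(0 <= i < n) c ^+ i * a i k) ^+ 2)
    @[n --> \oo] --> \sum_(k <- F) (w k * gamma k) ^+ 2.
  apply: cvg_seq_sum => k; apply: cvgM; apply: cvgMl_tmp; exact: cvg_geometric_coefficient.
rewrite -(cvg_lim (@Rhausdorff _) cv); apply: limr_le.
  by apply/cvg_ex; eexists; exact: cv.
apply: nearW => n.
apply: (@le_trans _ _ (\sum_(k <- F) 2 * \sum_(0 <= i < n) c ^+ i * (w k * a i k) ^+ 2)).
  apply: ler_sum => k _; rewrite mulr_sumr.
  under eq_bigr do rewrite mulrCA.
  exact: sqr_geometric_combination_le.
rewrite -mulr_sumr exchange_big/=.
apply: (@le_trans _ _ (2 * \sum_(0 <= i < n) c ^+ i)).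
  rewrite ler_wpM2l//; apply: ler_sum => i _; rewrite -mulr_sumr.
  by rewrite ler_piMr// exprn_ge0 ?invr_ge0.
have := @geometric_sum_le R 0 n; rewrite expr0; lra.
Qed.

End Combination.

(** Here [phi j] is the j-th functional, [L j] bounds its dual norm, and [S j] is a finite set
    carrying at least a quarter of [L j ^+ 2]. The lower bound is claimed for all large finite [F],
    so that it can be proved before any infinite sum is formed. *)
Lemma gliding_hump (w : K -> R) (phi : nat -> K -> R) (L : nat -> R)
    (S : nat -> {fset K}) :
  (forall k, 1 <= w k) -> (forall j, 0 < L j) ->
  (forall j F, \sum_(k <- F) (phi j k / w k) ^+ 2 <= L j ^+ 2) ->
  (forall j, L j ^+ 2 / 4 <= \sum_(k <- S j) (phi j k / w k) ^+ 2) ->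
  exists a : nat -> K -> R,
    [/\ forall i k, k \notin S i -> a i k = 0,
        forall i F, \sum_(k <- F) (w k * a i k) ^+ 2 <= 1 &
        forall j, exists F0, forall F, (F0 `<=` F)%fset ->
          c ^+ j * L j / 4 <= `|\sum_(k <- F) phi j k *
            limn (fun n => \sum_(0 <= i < n) c ^+ i * a i k)|].
Proof.
move=> w1 L0 phiL SL.
have w0 k : 0 < w k by exact: lt_le_trans (w1 k).
have wn k : w k != 0 by rewrite gt_eqF.
pose M j := Num.sqrt (\sum_(k <- S j) (phi j k / w k) ^+ 2).
have M2 j : M j ^+ 2 = \sum_(k <- S j) (phi j k / w k) ^+ 2.
  by rewrite sqr_sqrtr// sumr_ge0// => k _; rewrite sqr_ge0.
have LM j : L j / 2 <= M j.
  have L2 : 0 <= L j / 2 by rewrite divr_ge0// ltW.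
  rewrite -ler_sqr ?nnegrE ?sqrtr_ge0//.
  by rewrite M2 (le_trans _ (SL j))// expr_div_n -natrX.
have M0 j : 0 < M j by apply: lt_le_trans (LM j); rewrite divr_gt0.
(* Equality case of Cauchy-Schwarz: the normalised representer of [phi j] on [S j], of weighted norm
   1, on which the functional takes the value [M j]. *)
pose b j k := if k \in S j then phi j k / (w k ^+ 2 * M j) else 0.
have bS j k : k \notin S j -> b j k = 0 by rewrite /b => /negPf ->.
have b1 j F : \sum_(k <- F) (w k * b j k) ^+ 2 <= 1.
  apply: (@le_trans _ _ (\sum_(k <- (F `|` S j)%fset) (w k * b j k) ^+ 2)).
    by apply: le_fset_sum_nneg => [k|]; rewrite ?sqr_ge0 ?fsubsetUl.
  rewrite (@fset_sum_support _ (S j)) ?fsubsetUr//; last first.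
    by move=> k /bS ->; rewrite mulr0 expr0n.
  rewrite big_seq (eq_bigr (fun k => (phi j k / w k) ^+ 2 / M j ^+ 2)); last first.
    move=> k kS; rewrite /b kS; field.
    by rewrite gt_eqF//= wn.
  by rewrite -big_seq -mulr_suml -M2 divff// expf_neq0// gt_eqF.
pose m j i := \sum_(k <- S i) phi j k * b i k.
have mM j : m j j = M j.
  rewrite /m big_seq (eq_bigr (fun k => (phi j k / w k) ^+ 2 / M j)); last first.
    move=> k kS; rewrite /b kS; field.
    by rewrite gt_eqF//= wn.
  by rewrite -big_seq -mulr_suml -M2 expr2 mulfK// gt_eqF.
have [e e1 he] := signs_no_cancellation (fun j i => c ^+ i * m j i).
pose a i k := e i * b i k.
have aS i k : k \notin S i -> a i k = 0 by move=> /bS; rewrite /a => ->; rewrite mulr0.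
have a1 i F : \sum_(k <- F) (w k * a i k) ^+ 2 <= 1.
  rewrite (eq_bigr (fun k => (w k * b i k) ^+ 2))// => k _.
  by rewrite /a mulrCA exprMn -(real_normK (num_real (e i))) e1 expr1n mul1r.
have c0 i : 0 <= c ^+ i by rewrite exprn_ge0// invr_ge0.
exists a; split => // j.
(* [F] has to contain the supports of the humps 0 to [j], whose values are then the full [m j i] up
   to sign; the later humps can be estimated on any [F]. *)
exists (\bigcup_(i <- iota 0 j.+1) S i)%fset => F SF.
have SiF i : (i < j.+1)%N -> (S i `<=` F)%fset.
  move=> ij; apply: fsubset_trans SF; apply: bigfcup_sup => //.
  by rewrite mem_iota.
have cv : (\sum_(k <- F) phi j k * \sum_(0 <= i < n) c ^+ i * a i k)
    @[n --> \oo] --> \sum_(k <- F) phi j k *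
       limn (fun n => \sum_(0 <= i < n) c ^+ i * a i k).
  apply: cvg_seq_sum => k; apply: cvgMl_tmp; exact: cvg_geometric_coefficient w1 a1 k.
have /(_ (@filter_filter _ _ eventually_filter)) {}cv := cvg_norm cv.
rewrite -(cvg_lim (@Rhausdorff _) cv); apply: limr_ge.
  by apply/cvg_ex; eexists; exact: cv.
exists j.+1 => // n /= jn.
have -> : \sum_(k <- F) phi j k * (\sum_(0 <= i < n) c ^+ i * a i k) =
    \sum_(0 <= i < n) c ^+ i * \sum_(k <- F) phi j k * a i k.
  under eq_bigr do rewrite mulr_sumr.
  rewrite exchange_big/=; apply: eq_bigr => i _; rewrite mulr_sumr.
  by apply: eq_bigr => k _; rewrite mulrCA.
rewrite (big_cat_nat (leq0n j.+1) jn)//=.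
set s := (X in `|X + _|); set t := (X in `|_ + X|).
have sM : c ^+ j * M j <= `|s|.
  have -> : s = \sum_(0 <= i < j.+1) e i * (c ^+ i * m j i).
    apply: eq_big_nat => i /andP[_ /SiF ij].
    rewrite mulrCA; congr (_ * _); rewrite /m mulr_sumr.
    rewrite (fset_sum_support ij); last by move=> k /aS ->; rewrite mulr0.
    by apply: eq_bigr => k _; rewrite mulrCA.
  apply: le_trans (he j); rewrite mM ger0_norm// mulr_ge0// ltW//.
(* Every later hump has weighted norm at most 1, hence value at most [L j], and the weights from
   [j.+1] on sum to at most [c ^+ j / 7]. *)
have tL : `|t| <= L j * (8 / 7 * c ^+ j.+1).
  apply: le_trans (ler_norm_sum _ _ _) _.
  apply: (@le_trans _ _ (\sum_(j.+1 <= i < n) L j * c ^+ i)); last first.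
    rewrite -mulr_sumr ler_wpM2l ?geometric_sum_le//; exact: ltW.
  apply: ler_sum => i _; rewrite normrM ger0_norm// mulrC ler_wpM2r//.
  apply: le_trans (ler_norm_sum _ _ _) _.
  have := weighted_cauchy_schwarz w0 (L0 j) (phiL j F) (a1 i F).
  by rewrite -[1 + 1]/(2%:R) divff// mulr1.
(* In units of [c ^+ j * L j], the head is at least 1/2 and the tail at most 1/7; their difference
   exceeds 1/4. *)
have := lerB_normD s t.
have := LM j; have := c0 j; have := L0 j; move: sM tL; rewrite exprS.
move: (c ^+ j) => z; nra.
Qed.

End GlidingHump.

(** * Integration over the unit cube *)

Section CubeIntegral.
Context {R : realType}.

Lemma measurable_unit_cube d : measurable (@unit_cube R d).
Proof.
have -> : @unit_cube R d = \bigcap_(i in [set: 'I_d])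
    ((fun x : Rvec R d => tnth x i) @^-1` [set` `[(0:R), 1[ ]).
  apply/seteqP; split => x /= h i; first by move=> _ /=; rewrite in_itv/=.
  by have := h i I; rewrite /= in_itv/=.
apply: fin_bigcap_measurable; first exact: finite_finset.
move=> i _; rewrite -[X in measurable X]setTI.
by apply: (@measurable_tnth _ (measurableTypeR R) d i) => //.
Qed.

Lemma preimage_consvec_unit_cube n :
  @consvec R n @^-1` unit_cube = `[(0:R), 1[%classic `*` unit_cube.
Proof.
apply/seteqP; split => [[a x] h|[a x] [/= a01 h] i].
  split => /=; first by have := h ord0; rewrite in_itv.
  move=> i; have := h (lift ord0 i).
  by rewrite (tnth_nth 0)/= -tnth_nth.
rewrite (tnth_nth 0) /=; case: i => -[|i] /= ilt; first by move: a01; rewrite in_itv.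
by have := h (Ordinal (ilt : (i < n)%N)); rewrite (tnth_nth 0).
Qed.

Lemma measurable_itv01_unit_cube n :
  measurable (`[(0:R), 1[%classic `*` @unit_cube R n :
     set (measurableTypeR R * Rvec R n)).
Proof. by apply: measurableX; [exact: measurable_itv|exact: measurable_unit_cube]. Qed.

Lemma lebesgue_measure_itv01 : @lebesgue_measure R `[(0:R), 1[%classic = 1%E.
Proof. by rewrite lebesgue_measure_itv/= lte_fin ltr01 sube0. Qed.

Lemma lebesgue_vec_unit_cube d : lebesgue_vec R d unit_cube = 1%E.
Proof.
elim: d => [|n IH].
  by rewrite /= diracE mem_set// => -[].
rewrite [LHS]/= /lebesgue_cons /pushforward preimage_consvec_unit_cube.
rewrite product_measure1E; [|exact: measurable_itv|exact: measurable_unit_cube].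
rewrite -[X in (_ * X)%E = _]/(lebesgue_vec R n unit_cube) IH mule1.
exact: lebesgue_measure_itv01.
Qed.

Lemma integrable_unit_cube_bounded d (f : Rvec R d -> R) (M : R) :
  measurable_fun [set: Rvec R d] f -> (forall x, `|f x| <= M) ->
  (lebesgue_vec R d).-integrable unit_cube (EFin \o f).
Proof.
move=> mf fM; apply: measurable_bounded_integrable.
- exact: measurable_unit_cube.
- by rewrite [ltLHS]lebesgue_vec_unit_cube ltry.
- exact: measurable_funTS.
- exists M; split; [exact: num_real|move=> y My x _; exact: le_trans (fM _) (ltW My)].
Qed.

(** Boundedness on a cube of measure 1 supplies the integrability required by Fubini's theorem. *)
Lemma integral_unit_cubeS n (f : Rvec R n.+1 -> R) (M : R) :
  measurable_fun [set: Rvec R n.+1] f -> (forall x, `|f x| <= M) ->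
  (\int[lebesgue_vec R n.+1]_(x in unit_cube) (f x)%:E =
   \int[@lebesgue_measure R]_(a in `[0%R, 1%R[)
     \int[lebesgue_vec R n]_(y in unit_cube) (f (consvec (a, y)))%:E)%E.
Proof.
move=> mf fM; have mc := @measurable_consvec R n.
pose P : {measure set (measurableTypeR R * Rvec R n) -> \bar R} :=
  (@lebesgue_measure R \x lebesgue_vec R n)%E.
pose AB : set (measurableTypeR R * Rvec R n) := `[(0:R), 1[%classic `*` unit_cube.
have mAB : measurable AB := @measurable_itv01_unit_cube n.
have mg : measurable_fun setT (f \o @consvec R n) by exact: measurableT_comp.
have PAB : P AB = 1%E.
  transitivity (@lebesgue_measure R `[0%R, 1%R[%classic * lebesgue_vec R n unit_cube)%E.
    by apply: product_measure1E; [exact: measurable_itv|exact: measurable_unit_cube].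
  by rewrite lebesgue_vec_unit_cube mule1; exact: lebesgue_measure_itv01.
have iAB : P.-integrable AB (EFin \o (f \o @consvec R n)).
  apply: measurable_bounded_integrable => //.
  - by rewrite [ltLHS]PAB ltry.
  - exact: measurable_funTS.
  - exists M; split; [exact: num_real|move=> y My x _; exact: le_trans (fM _) (ltW My)].
transitivity (\int[pushforward P (@consvec R n)]_(x in unit_cube) (f x)%:E)%E.
  by apply: eq_measure_integral.
rewrite integral_pushforward//=; last 3 first.
- exact/measurable_EFinP.
- by rewrite preimage_consvec_unit_cube.
- exact: measurable_unit_cube.
rewrite preimage_consvec_unit_cube integral_mkcond -integral12_prod_meas1; last first.
  by apply: (iffLR (integrable_mkcond _ mAB)); exact: iAB.
rewrite [RHS]integral_mkcond; apply: eq_integral => a _.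
rewrite /fubini_F patchE; case: ifPn => aA.
  rewrite [RHS]integral_mkcond; apply: eq_integral => y _.
  by rewrite !patchE in_setX aA.
by apply: integral0_eq => y _; rewrite patchE in_setX (negPf aA).
Qed.

(** * Integrals of shifted cosines over a period and over the cube *)

Lemma cosD2piz (x : R) (m : int) : cos (x + 2 * pi * m%:~R) = cos x.
Proof.
have nat_case (y : R) (n : nat) : cos (y + 2 * pi * n%:R) = cos y.
  by rewrite -mulrA mulr_natl -mulrnAl mulr_natr (periodicn (@cosD2pi R)).
case: m => n; first exact: nat_case.
by rewrite NegzE mulrNz mulrN -[LHS](nat_case _ n.+1) subrK.
Qed.

Lemma sinD2piz (x : R) (m : int) : sin (x + 2 * pi * m%:~R) = sin x.
Proof. by rewrite -cosBpihalf addrAC cosD2piz cosBpihalf. Qed.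

(** For nonzero [m] the antiderivative takes equal values at 0 and 1, by periodicity of the sine. *)
Lemma integral_cos_period (m : int) (b : R) :
  (\int[@lebesgue_measure R]_(a in `[0%R, 1%R[) (cos (2 * pi * (a * m%:~R) + b))%:E =
   if m == 0%R then (cos b)%:E else 0)%E.
Proof.
have [->|m0] := eqVneq m 0.
  under eq_integral do rewrite mulr0 mulr0 add0r.
  rewrite integral_cst; last exact: measurable_itv.
  by rewrite [X in (_ * X)%E]lebesgue_measure_itv01 mule1.
pose s : R := 2 * pi * m%:~R.
have pi0 : pi != 0 :> R by rewrite gt_eqF ?pi_gt0.
have s0 : s != 0 by rewrite /s !mulf_neq0// intr_eq0.
have -> : (fun a : R => (cos (2 * pi * (a * m%:~R) + b))%:E) =
          (fun a : R => (cos (s * a + b))%:E).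
  by apply/funext => a; rewrite /s -mulrA [a * _]mulrC !mulrA.
have ds (a : R) : is_derive a (1:R) (fun a => s^-1 * sin (s * a + b)) (cos (s * a + b)).
  apply: is_derive_eq.
  by rewrite /GRing.scale/= mulr1 addr0 mulrCA mulVf// mulr1.
have cs : continuous (fun a : R => cos (s * a + b)).
  move=> a; apply: continuous_comp; last exact: continuous_cos.
  by apply: cvgD; [apply: cvgMl_tmp; exact: cvg_id|exact: cvg_cst].
have cd : continuous (fun a => s^-1 * sin (s * a + b)).
  by move=> a; apply: differentiable_continuous; apply/derivable1_diffP; apply: ex_derive.
rewrite integral_itv_bndo_bndc; last first.
  by apply/measurable_EFinP/measurable_funTS; exact: continuous_measurable_fun.
rewrite (@continuous_FTC2 _ _ (fun a => s^-1 * sin (s * a + b))) ?ltr01//.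
- rewrite mulr1 mulr0 add0r -EFinB -mulrBr.
  by rewrite [s + b]addrC sinD2piz subrr mulr0.
- exact: continuous_subspaceT.
- split => [a _||].
  + exact: ex_derive.
  + by apply: cvg_at_right_filter; exact: cd.
  + by apply: cvg_at_left_filter; exact: cd.
- by move=> a _; rewrite derive1E; exact: derive_val.
Qed.

Lemma measurable_dot d (k : d.-tuple int) :
  measurable_fun [set: Rvec R d] (fun x => dot x k : measurableTypeR R).
Proof.
apply: measurable_sum => i; apply: measurable_funM; last exact: measurable_cst.
exact: (@measurable_tnth _ (measurableTypeR R) d i).
Qed.

Lemma measurable_cos_dot d (k : d.-tuple int) (b : R) :
  measurable_fun [set: Rvec R d] (fun x => cos (2 * pi * dot x k + b)).
Proof.
apply: measurableT_comp; first exact: (continuous_measurable_fun (@continuous_cos R)).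
apply: measurable_funD; last exact: measurable_cst.
apply: measurable_funM; [exact: measurable_cst|exact: measurable_dot].
Qed.

(** Induction on the dimension through Fubini. The phase [b] is general so that the first coordinate
    can be absorbed into it while the others are integrated. *)
Lemma integral_cos_dot d (k : d.-tuple int) (b : R) :
  (\int[lebesgue_vec R d]_(x in unit_cube) (cos (2 * pi * dot x k + b))%:E =
   if k == freq0 then (cos b)%:E else 0)%E.
Proof.
elim: d k b => [|n IH] k b.
  rewrite integral_dirac; last 2 first.
  - exact: measurable_unit_cube.
  - apply: measurable_funTS; apply/measurable_EFinP; exact: measurable_cos_dot.
  rewrite diracE mem_set ?mul1e; last by case.
  by rewrite /dot big_ord0 mulr0 add0r (tuple0 freq0) (tuple0 k) eqxx.
case/tupleP: k => m k.
have dotE a (y : Rvec R n) : dot (consvec (a, y)) [tuple of m :: k] = a * m%:~R + dot y k.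
  rewrite /dot big_ord_recl; congr (_ + _).
  by apply: eq_bigr => i _; rewrite !tnthS.
rewrite (@integral_unit_cubeS _ _ 1); last 2 first.
- exact: measurable_cos_dot.
- by move=> x; exact: cos_max.
under eq_integral => a _.
  under eq_integral do rewrite dotE mulrDr addrAC.
  under eq_integral do rewrite addrC.
  rewrite IH; over.
have -> : ([tuple of m :: k] == freq0 :> n.+1.-tuple int) = (m == 0) && (k == freq0).
  apply/eqP/andP => [h|[/eqP -> /eqP ->]].
    split; apply/eqP.
      by have := congr1 (fun t : n.+1.-tuple int => tnth t ord0) h; rewrite !tnth_mktuple.
    apply/eq_from_tnth => i.
    have := congr1 (fun t : n.+1.-tuple int => tnth t (lift ord0 i)) h.
    by rewrite tnthS !tnth_mktuple.
  apply/eq_from_tnth => i; rewrite tnth_mktuple.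
  by case: (unliftP ord0 i) => [j ->|->]; rewrite ?tnthS ?tnth_mktuple.
have [_|_] := eqVneq k freq0; last by rewrite andbF integral0.
by rewrite andbT integral_cos_period.
Qed.

End CubeIntegral.

(** * Trigonometric series on the torus *)

Section TrigonometricSeries.
Context {R : realType} {d : nat}.
Local Notation K := (d.-tuple int).
Local Notation c := (8^-1 : R).
Local Notation mu := (lebesgue_vec R d).
Implicit Types (x : Rvec R d) (k l : K) (a : K -> R) (S : {fset K}).

Definition phase k x : R := 2 * pi * dot x k.

Lemma phaseB k l x :
  phase l x - phase k x = phase [tuple tnth l i - tnth k i | i < d] x.
Proof.
rewrite /phase /dot -mulrBr; congr (_ * _); rewrite -sumrB.
by apply: eq_bigr => i _; rewrite tnth_mktuple rmorphB/= mulrBr.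
Qed.

Lemma integral_cos_phaseB k l (b : R) :
  (\int[mu]_(x in unit_cube) (cos (phase l x - phase k x + b))%:E =
   if l == k then (cos b)%:E else 0)%E.
Proof.
under eq_integral do rewrite phaseB.
rewrite integral_cos_dot; congr (if _ then _ else _).
apply/eqP/eqP => [h|->].
  apply/eq_from_tnth => i; apply/eqP; rewrite -subr_eq0; apply/eqP.
  by have := congr1 (fun t : K => tnth t i) h; rewrite !tnth_mktuple.
by apply/eq_from_tnth => i; rewrite !tnth_mktuple subrr.
Qed.

(* For real a, [b = 0] gives the real part of \sum_l a_l e^{2 pi i l.x} and
   [b = - (pi / 2)] its imaginary part. *)
Definition trig_poly a S (b : R) x : R :=
  \sum_(l <- S) a l * cos (phase l x + b).

Lemma measurable_trig_poly a S b : measurable_fun [set: Rvec R d] (trig_poly a S b).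
Proof.
apply: measurable_sum => l; apply: measurable_funM; first exact: measurable_cst.
exact: measurable_cos_dot.
Qed.

Lemma phase_periodic (m : d.-tuple int) x k : exists z : int,
  phase k [tuple (tnth x i : R) + (tnth m i)%:~R | i < d] = phase k x + 2 * pi * z%:~R.
Proof.
exists (\sum_(i < d) tnth m i * tnth k i).
rewrite /phase -mulrDr; congr (_ * _); rewrite rmorph_sum/= /dot -big_split/=.
by apply: eq_bigr => i _; rewrite tnth_mktuple mulrDl intrM.
Qed.

Lemma trig_poly_periodic a S b (m : d.-tuple int) x :
  trig_poly a S b [tuple (tnth x i : R) + (tnth m i)%:~R | i < d] = trig_poly a S b x.
Proof.
apply: eq_bigr => l _; congr (_ * _).
by have [z ->] := phase_periodic m x l; rewrite addrAC cosD2piz.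
Qed.

(** Orthogonality keeps only the term [l = k], and for [k] outside [S] both sides vanish. *)
Lemma integral_trig_poly_shift a S b k : (forall l, l \notin S -> a l = 0) ->
  (\int[mu]_(x in unit_cube)
     (\sum_(l <- S) a l * cos (phase l x - phase k x + b))%:E = (a k * cos b)%:E)%E.
Proof.
move=> aS.
have ic l : mu.-integrable unit_cube
    (fun x => (a l)%:E * (cos (phase l x - phase k x + b))%:E)%E.
  apply: integrableZl; first exact: measurable_unit_cube.
  apply: (@integrable_unit_cube_bounded _ _ _ 1); last by move=> x; exact: cos_max.
  under eq_fun do rewrite phaseB; exact: measurable_cos_dot.
under eq_integral do rewrite -sumEFin.
under eq_integral do under eq_bigr do rewrite EFinM.
rewrite (integral_sum (@measurable_unit_cube R d) ic).
rewrite (eq_bigr (fun l => if l == k then (a k * cos b)%:E else 0%E)); last first.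
  move=> l _; rewrite (integralZl (@measurable_unit_cube R d)); last first.
    apply: (@integrable_unit_cube_bounded _ _ _ 1); last by move=> x; exact: cos_max.
    under eq_fun do rewrite phaseB; exact: measurable_cos_dot.
  by rewrite integral_cos_phaseB; case: eqP => [->|]; rewrite ?mule0.
rewrite -big_mkcond/=; have [kS|kS] := boolP (k \in S).
  by rewrite -big_filter (filter_pred1_uniq (fset_uniq S) kS) big_seq1.
by rewrite (aS _ kS) mul0r big1.
Qed.

(** Two expansions of the real part of [p(x) e^{-i (phase k x - b)}], where [p] is the trigonometric
    polynomial with coefficients [a]. *)
Lemma trig_poly_shift a S k (b : R) x :
  \sum_(l <- S) a l * cos (phase l x - phase k x + b) =
  trig_poly a S 0 x * cos (phase k x - b) +
  trig_poly a S (- (pi / 2)) x * sin (phase k x - b).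
Proof.
rewrite /trig_poly !mulr_suml -big_split/=; apply: eq_bigr => l _.
rewrite -!mulrA -mulrDr; congr (_ * _).
by rewrite addr0 cosBpihalf -cosB; congr cos; ring.
Qed.

(** Parseval's identity. Expanding only one factor of [p] times its conjugate leaves shifted sums
    whose integrals are already known. *)
Lemma integral_trig_poly_sqr a S : (forall l, l \notin S -> a l = 0) ->
  (\int[mu]_(x in unit_cube)
     (trig_poly a S 0 x ^+ 2 + trig_poly a S (- (pi / 2)) x ^+ 2)%:E =
   (\sum_(l <- S) a l ^+ 2)%:E)%E.
Proof.
move=> aS.
have E x : trig_poly a S 0 x ^+ 2 + trig_poly a S (- (pi / 2)) x ^+ 2 =
    \sum_(k <- S) a k * \sum_(l <- S) a l * cos (phase l x - phase k x + 0).
  under eq_bigr do rewrite trig_poly_shift mulrDr.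
  rewrite big_split/= !expr2 {2 4}/trig_poly !mulr_sumr.
  congr (_ + _); apply: eq_bigr => k _; rewrite mulrCA; congr (_ * (_ * _)).
    by rewrite subr0 addr0.
  by rewrite subr0 cosBpihalf.
under eq_integral do rewrite E -sumEFin.
under eq_integral do under eq_bigr do rewrite EFinM.
have mT k : measurable_fun [set: Rvec R d]
    (fun x => \sum_(l <- S) a l * cos (phase l x - phase k x + 0)).
  apply: measurable_sum => l; apply: measurable_funM; first exact: measurable_cst.
  by under eq_fun do rewrite phaseB; exact: measurable_cos_dot.
have iT k : mu.-integrable unit_cube
    (fun x => (\sum_(l <- S) a l * cos (phase l x - phase k x + 0))%:E).
  apply: (@integrable_unit_cube_bounded _ _ _ (\sum_(l <- S) `|a l|)) => // x.
  apply: le_trans (ler_norm_sum _ _ _) _; apply: ler_sum => l _.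
  by rewrite normrM ler_piMr// cos_max.
rewrite integral_sum; [|exact: measurable_unit_cube|]; last first.
  by move=> k; apply: integrableZl => //; exact: measurable_unit_cube.
rewrite -sumEFin; apply: eq_bigr => k _.
rewrite (integralZl (@measurable_unit_cube R d))//.
by rewrite integral_trig_poly_shift// cos0 mulr1 -EFinM expr2.
Qed.

(** * Riesz-Fischer for a geometric series of trigonometric polynomials *)

Section RieszFischer.
Variables (a : nat -> K -> R) (S : nat -> {fset K}).
Hypothesis aS : forall i l, l \notin S i -> a i l = 0.
Hypothesis a1 : forall i (F : {fset K}), \sum_(l <- F) a i l ^+ 2 <= 1.

Let A i x := trig_poly (a i) (S i) 0 x.
Let B i x := trig_poly (a i) (S i) (- (pi / 2)) x.
Let Q x : \bar R := (\sum_(0 <= i <oo) (c ^+ i * (A i x ^+ 2 + B i x ^+ 2))%:E)%E.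
(* The series defining g is only summed on [good], which has full measure. *)
Let good : set (Rvec R d) := [set x | (Q x < +oo)%E].

Let c0 i : 0 <= c ^+ i. Proof. by rewrite exprn_ge0// invr_ge0. Qed.

Let term_ge0 i x : 0 <= c ^+ i * (A i x ^+ 2 + B i x ^+ 2).
Proof. by rewrite mulr_ge0// addr_ge0// sqr_ge0. Qed.

Let mA i : measurable_fun [set: Rvec R d] (A i).
Proof. exact: measurable_trig_poly. Qed.

Let mB i : measurable_fun [set: Rvec R d] (B i).
Proof. exact: measurable_trig_poly. Qed.

Let mterm i : measurable_fun [set: Rvec R d]
  (fun x => (c ^+ i * (A i x ^+ 2 + B i x ^+ 2))%:E).
Proof.
apply/measurable_EFinP; apply: measurable_funM; first exact: measurable_cst.
by apply: measurable_funD; apply: measurable_funX.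
Qed.

Let mQ : measurable_fun [set: Rvec R d] Q.
Proof.
have -> : Q = (fun x => \sum_(0 <= i <oo | i \in predT)
    (c ^+ i * (A i x ^+ 2 + B i x ^+ 2))%:E)%E by [].
by apply: ge0_emeasurable_sum => //= i x _ _; rewrite lee_fin.
Qed.

Let Q_ge0 x : (0 <= Q x)%E.
Proof. by apply: nneseries_ge0 => i _ _; rewrite lee_fin. Qed.

(** Monotone convergence and Parseval bound the integral by the sum of the weights, 8/7. *)
Let integral_Q : (\int[mu]_(x in unit_cube) Q x <= 2%:E)%E.
Proof.
rewrite integral_nneseries; last 3 first.
- exact: measurable_unit_cube.
- by move=> i; apply: measurable_funTS; exact: mterm.
- by move=> i x _; rewrite lee_fin.
apply: lime_le.
  apply: is_cvg_nneseries => i _ _; apply: integral_ge0 => x _.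
  by rewrite lee_fin.
apply: nearW => n.
apply: (@le_trans _ _ (\sum_(0 <= i < n) (c ^+ i)%:E)%E); last first.
  rewrite sumEFin lee_fin; apply: le_trans (geometric_sum_le 0 n) _.
  by rewrite expr0; lra.
apply: lee_sum => i _; under eq_integral do rewrite EFinM.
rewrite ge0_integralZl; last 4 first.
- exact: measurable_unit_cube.
- apply: measurable_funTS; apply/measurable_EFinP.
  by apply: measurable_funD; apply: measurable_funX.
- by move=> x _; rewrite lee_fin addr_ge0// sqr_ge0.
- by rewrite lee_fin.
by rewrite integral_trig_poly_sqr//; [rewrite -EFinM lee_fin ler_piMr|exact: aS].
Qed.

Let integrable_Q : mu.-integrable unit_cube Q.
Proof.
apply/integrableP; split; first exact: measurable_funTS.
under eq_integral do rewrite gee0_abs//.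
by apply: le_lt_trans integral_Q _; rewrite ltry.
Qed.

Let measurable_good : measurable good.
Proof.
have -> : good = setT `&` (Q @^-1` (~` [set +oo%E])).
  rewrite setTI; apply/seteqP; split => x /=; rewrite /good/= lt_neqAle leey andbT.
    by move=> /eqP.
  by move=> h; apply/eqP.
by apply: mQ => //; apply: measurableC; exact: emeasurable_set1.
Qed.

Let indic_good1 x : good x -> \1_good x = 1 :> R.
Proof. by move=> gx; rewrite indicE mem_set. Qed.

Let indic_good0 x : ~ good x -> \1_good x = 0 :> R.
Proof. by move=> bx; rewrite indicE memNset. Qed.

(** The indicator makes the partial sums converge at every point, to 0 off [good], so that their
    limit is measurable. [T] will be [A] or [B]. *)
Let part (T : nat -> Rvec R d -> R) n x : R :=
  \1_good x * \sum_(0 <= i < n) c ^+ i * T i x.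

Section Component.
Variable T : nat -> Rvec R d -> R.
Hypothesis mT : forall i, measurable_fun [set: Rvec R d] (T i).
Hypothesis TAB : forall i x, T i x ^+ 2 <= A i x ^+ 2 + B i x ^+ 2.

Let partial_sqr n x :
  (((\sum_(0 <= i < n) c ^+ i * T i x) ^+ 2)%:E <= 2%:E * Q x)%E.
Proof.
apply: (@le_trans _ _ (2%:E * \sum_(0 <= i < n) (c ^+ i * (A i x ^+ 2 + B i x ^+ 2))%:E)%E).
  rewrite sumEFin -EFinM lee_fin; apply: le_trans (sqr_geometric_combination_le _ _) _.
  by rewrite ler_wpM2l//; apply: ler_sum => i _; rewrite ler_wpM2l.
rewrite lee_wpmul2l ?lee_fin//.
by apply: nneseries_lim_ge => i _ _; rewrite lee_fin.
Qed.

(** The inequality [|s| <= 1 + s ^+ 2] turns the bound on squares into an integrable majorant for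
    dominated convergence. *)
Lemma partial_sum_le n x :
  (`|\sum_(0 <= i < n) c ^+ i * T i x|%:E <= 1 + 2%:E * Q x)%E.
Proof.
apply: le_trans (leeD2l 1%E (partial_sqr n x)); rewrite -EFinD lee_fin.
move: (\sum_(0 <= i < n) _) => s; rewrite -(real_normK (num_real s)).
have := sqr_ge0 (`|s| - 1); have := normr_ge0 s; nra.
Qed.

Let is_cvg_partial x : good x -> cvgn (fun n => \sum_(0 <= i < n) c ^+ i * T i x).
Proof.
move=> gx; apply: (@normed_cvg _ _ (fun i => c ^+ i * T i x)).
(* Since [|T| <= 1 + T ^+ 2], the geometric series and the series of [Q], finite at [x], together
   dominate. *)
apply: (@series_le_cvg _ _ (fun i => 1 * c ^+ i + c ^+ i * (A i x ^+ 2 + B i x ^+ 2))).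
- by move=> n; exact: normr_ge0.
- by move=> n; rewrite mul1r addr_ge0.
- move=> n /=; rewrite normrM ger0_norm// [1 * _]mulrC -mulrDr ler_wpM2l//.
  apply: le_trans (lerD (lexx 1) (TAB n x)).
  rewrite -(real_normK (num_real (T n x))).
  have := sqr_ge0 (`|T n x| - 1); have := normr_ge0 (T n x); nra.
- apply: is_cvg_seriesD.
    apply: is_cvg_geometric_series.
    by rewrite ger0_norm ?invr_ge0// invf_lt1// ltr1n.
  by apply: nnseries_is_cvg.
Qed.

Definition component x : R := limn (fun n => part T n x).

Let part_good x : good x -> part T ^~ x = (fun n => \sum_(0 <= i < n) c ^+ i * T i x).
Proof. by move=> gx; apply/funext => n; rewrite /part (indic_good1 gx) mul1r. Qed.

Let part_bad x : ~ good x -> part T ^~ x = cst 0.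
Proof. by move=> bx; apply/funext => n; rewrite /part (indic_good0 bx) mul0r. Qed.

Let component_bad x : ~ good x -> component x = 0.
Proof. by move=> bx; rewrite /component part_bad// lim_cst. Qed.

Lemma cvg_component x : good x ->
  (\sum_(0 <= i < n) c ^+ i * T i x) @[n --> \oo] --> component x.
Proof. by move=> gx; rewrite /component part_good//; exact: is_cvg_partial. Qed.

Lemma measurable_component : measurable_fun [set: Rvec R d] component.
Proof.
apply: (@measurable_fun_cvg _ _ _ _ (part T)).
  move=> n; apply: measurable_funM.
    exact: measurable_indic.
  apply: measurable_sum => i; apply: measurable_funM; first exact: measurable_cst.
  exact: mT.
move=> x _; have [gx|bx] := pselect (good x).
  by rewrite part_good//; exact: cvg_component.
by rewrite component_bad// part_bad//; exact: cvg_cst.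
Qed.

Lemma component_sqr_le x : ((component x ^+ 2)%:E <= 2%:E * Q x)%E.
Proof.
have [gx|bx] := pselect (good x); last first.
  by rewrite component_bad// expr0n/= mule_ge0// lee_fin.
have Qfin : (2%:E * Q x)%E \is a fin_num.
  by rewrite fin_numM// ge0_fin_numE.
rewrite -(fineK Qfin) lee_fin.
have cv : (\sum_(0 <= i < n) c ^+ i * T i x) ^+ 2 @[n --> \oo] --> component x ^+ 2.
  by apply: cvgM; exact: cvg_component.
rewrite -(cvg_lim (@Rhausdorff _) cv); apply: limr_le.
  by apply/cvg_ex; eexists; exact: cv.
by apply: nearW => n; rewrite -lee_fin fineK//; exact: partial_sqr.
Qed.

Lemma component_periodic (m : d.-tuple int) :
  (forall i x, T i [tuple (tnth x i : R) + (tnth m i)%:~R | i < d] = T i x) ->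
  forall x, component [tuple (tnth x i : R) + (tnth m i)%:~R | i < d] = component x.
Proof.
move=> Tm x; rewrite /component; congr (limn _); apply/funext => n.
rewrite /part; congr (_ * _); last by apply: eq_bigr => i _; rewrite Tm.
(* [Q] is built from periodic polynomials, so [good] is invariant under integer translations. *)
have Qm : Q [tuple (tnth x i : R) + (tnth m i)%:~R | i < d] = Q x.
  by apply: eq_eseriesr => i _; rewrite /A /B !trig_poly_periodic.
have [gx|bx] := pselect (good x).
  by rewrite !indic_good1// /good/= Qm.
by rewrite !indic_good0// /good/= Qm.
Qed.

End Component.

Let TA i x : A i x ^+ 2 <= A i x ^+ 2 + B i x ^+ 2.
Proof. by rewrite lerDl sqr_ge0. Qed.

Let TB i x : B i x ^+ 2 <= A i x ^+ 2 + B i x ^+ 2.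
Proof. by rewrite lerDr sqr_ge0. Qed.

Let g x : R[i] := component A x +i* component B x.

(** The integrand is the real part of [g(x) e^{-i (phase k x - b)}]; dominated convergence allows
    integration term by term. *)
Let integral_g_shift k (b : R) :
  \int[mu]_(x in unit_cube)
    (component A x * cos (phase k x - b) + component B x * sin (phase k x - b)) =
  limn (fun n => \sum_(0 <= i < n) c ^+ i * a i k) * cos b.
Proof.
have mphase : measurable_fun [set: Rvec R d] (fun x => cos (phase k x - b)).
  exact: measurable_cos_dot.
have mphase' : measurable_fun [set: Rvec R d] (fun x => sin (phase k x - b)).
  under eq_fun do rewrite -cosBpihalf -addrA; exact: measurable_cos_dot.
pose f n x :=
  \sum_(0 <= i < n) c ^+ i * (A i x * cos (phase k x - b) + B i x * sin (phase k x - b)).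
have fE n x : f n x = (\sum_(0 <= i < n) c ^+ i * A i x) * cos (phase k x - b) +
    (\sum_(0 <= i < n) c ^+ i * B i x) * sin (phase k x - b).
  by rewrite !mulr_suml -big_split/=; apply: eq_bigr => i _; rewrite mulrDr !mulrA.
have mshift i : measurable_fun [set: Rvec R d]
    (fun x => A i x * cos (phase k x - b) + B i x * sin (phase k x - b)).
  by apply: measurable_funD; apply: measurable_funM.
have mf n : measurable_fun [set: Rvec R d] (f n).
  apply: measurable_sum => i; apply: measurable_funM => //; exact: measurable_cst.
have ishift i : mu.-integrable unit_cube
    (fun x => (A i x * cos (phase k x - b) + B i x * sin (phase k x - b))%:E).
  apply: (@integrable_unit_cube_bounded _ _ _ (\sum_(l <- S i) `|a i l|)) => // x.
  rewrite -trig_poly_shift; apply: le_trans (ler_norm_sum _ _ _) _.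
  by apply: ler_sum => l _; rewrite normrM ler_piMr// cos_max.
(* The majorant contains one copy of [1 + 2 Q] for each of the two components. *)
have [] := @dominated_convergence _ _ _ mu unit_cube (@measurable_unit_cube R d)
  (fun n x => (f n x)%:E)
  (fun x => (component A x * cos (phase k x - b) + component B x * sin (phase k x - b))%:E)
  (fun x => 2%:E * (1 + 2%:E * Q x))%E.
- by move=> n; apply: measurable_funTS; apply/measurable_EFinP.
- apply: measurable_funTS; apply/measurable_EFinP.
  apply: measurable_funD; apply: measurable_funM => //; exact: measurable_component.
(* Being integrable, [Q] is finite almost everywhere, and the series converge wherever it is
   finite. *)
- have := integrable_ae (@measurable_unit_cube R d) integrable_Q.
  apply: filterS => x Qx cx; have gx : good x by rewrite /good/= -ge0_fin_numE// Qx.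
  apply/cvg_EFin; first exact: nearW.
  rewrite (_ : fine \o _ = f ^~ x)//.
  under [f ^~ x]funext => n do rewrite fE.
  by apply: cvgD; apply: cvgMr_tmp; exact: cvg_component.
- apply: integrableZl; first exact: measurable_unit_cube.
  apply: integrableD; first exact: measurable_unit_cube.
    by apply: (@integrable_unit_cube_bounded _ _ (cst 1) 1) => // x; rewrite normr1.
  by apply: integrableZl => //; exact: measurable_unit_cube.
- apply: aeW => x n _; rewrite fE.
  have hA := partial_sum_le TA n x; have hB := partial_sum_le TB n x.
  apply: le_trans (_ : ((1 + 2%:E * Q x) + (1 + 2%:E * Q x) <= _)%E); last first.
    by rewrite -[X in (X + X)%E]mul1e -ge0_muleDl// ?lee_fin.
  apply: le_trans (leeD hA hB); rewrite -EFinD lee_fin.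
  apply: le_trans (ler_normD _ _) _; rewrite !normrM.
  by apply: lerD; rewrite ler_piMr// ?cos_max ?sin_max.
move=> _ _ /=.
have -> : (fun n => \int[mu]_(x in unit_cube) (f n x)%:E)%E =
    (fun n => ((\sum_(0 <= i < n) c ^+ i * a i k) * cos b)%:E).
  apply/funext => n; rewrite mulr_suml -sumEFin.
  under eq_integral do rewrite -sumEFin.
  under eq_integral do under eq_bigr do rewrite EFinM.
  rewrite (integral_sum (@measurable_unit_cube R d)).
    apply: eq_bigr => i _; rewrite (integralZl (@measurable_unit_cube R d))//.
    under eq_integral do rewrite -trig_poly_shift.
    by rewrite integral_trig_poly_shift; [rewrite -EFinM mulrA|exact: aS].
  by move=> i; apply: integrableZl => //; exact: measurable_unit_cube.
move=> cv1.
have cv2 : ((\sum_(0 <= i < n) c ^+ i * a i k) * cos b)%:E @[n --> \oo] -->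
    (limn (fun n => \sum_(0 <= i < n) c ^+ i * a i k) * cos b)%:E.
  apply: cvg_EFin; first exact: nearW.
  apply: cvgMr_tmp; apply: (is_cvg_geometric_combination (M := 1)) => i.
  have := a1 i [fset k]%fset; rewrite big_seq_fset1 => h.
  by rewrite -[leRHS]normr1 -ler_sqr ?nnegrE// !real_normK ?num_real// expr1n.
by rewrite /Rintegral (cvg_unique _ cv1 cv2).
Qed.

Lemma riesz_fischer : exists2 f : Rvec R d -> R[i], L2_torus f &
  forall k, fourier f k = (limn (fun n => \sum_(0 <= i < n) c ^+ i * a i k))%:C.
Proof.
exists g => [|k].
  split=> [x m|||].
  - congr (_ +i* _); apply: component_periodic => i y; exact: trig_poly_periodic.
  - exact: measurable_component.
  - exact: measurable_component.
  have normE x : Normc.normc (g x) ^+ 2 = component A x ^+ 2 + component B x ^+ 2.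
    by rewrite /= sqr_sqrtr// addr_ge0// sqr_ge0.
  apply: (@le_lt_trans _ _ (\int[mu]_(x in unit_cube) (2%:E * Q x + 2%:E * Q x))%E).
    apply: ge0_le_integral.
    - exact: measurable_unit_cube.
    - by move=> x _; rewrite lee_fin sqr_ge0.
    - apply: measurable_funTS; apply/measurable_EFinP.
      under eq_fun do rewrite normE.
      by apply: measurable_funD; apply: measurable_funX; exact: measurable_component.
    - by apply: measurable_funTS; apply: emeasurable_funD; apply: measurable_funeM.
    - move=> x _; rewrite normE EFinD.
      exact: leeD (component_sqr_le TA x) (component_sqr_le TB x).
  apply: integrable_lty; first exact: measurable_unit_cube.
  have i2Q : mu.-integrable unit_cube (fun x => 2%:E * Q x)%E.
    by apply: integrableZl => //; exact: measurable_unit_cube.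
  by apply: integrableD => //; exact: measurable_unit_cube.
have cosN2 (y : R) : cos (y - - (pi / 2)) = - sin y by rewrite opprK cosDpihalf.
have sinN2 (y : R) : sin (y - - (pi / 2)) = cos y by rewrite opprK sinDpihalf.
set gamma := limn _; rewrite /fourier /integral_torus.
apply/eqP; rewrite eq_complex/=; apply/andP; split; apply/eqP.
  transitivity (gamma * cos 0); last by rewrite cos0 mulr1.
  rewrite -integral_g_shift; apply: eq_Rintegral => x _ /=.
  by rewrite /phase subr0 cosN sinN mulrN opprK.
(* The shift [b = - (pi / 2)] selects the imaginary part of the coefficient, and [cos b = 0] makes
   it vanish. *)
transitivity (gamma * cos (- (pi / 2))); last by rewrite cosN cos_pihalf mulr0.
rewrite -integral_g_shift; apply: eq_Rintegral => x _ /=.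
by rewrite cosN2 sinN2 /phase cosN sinN !mulrN.
Qed.

End RieszFischer.

End TrigonometricSeries.

(** * Sobolev norms *)

Section SobolevWeight.
Context {R : realType} {d : nat} (q : R).
Hypothesis q0 : 0 < q.
Local Notation K := (d.-tuple int).
Implicit Types (f g : Rvec R d -> R[i]) (k : K) (F : {fset K}).

(* The value at [freq0] is immaterial for mean-zero functions. *)
Definition sobolev_weight k : R := if k == freq0 then 1 else enorm k `^ q.

Lemma enorm_ge1 k : k != freq0 -> 1 <= enorm k :> R.
Proof.
move=> k0; have [i ki] : exists i, tnth k i != 0.
  apply: contrapT => h; move/eqP: k0; apply; apply/eq_from_tnth => i.
  by rewrite tnth_mktuple; apply: contrapT => ki; apply: h; exists i; apply/eqP.
rewrite /enorm -[leLHS]sqrtr1; apply: ler_wsqrtr.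
rewrite (bigD1 i)//= -[leLHS]addr0; apply: lerD; last first.
  by apply: sumr_ge0 => j _; rewrite sqr_ge0.
rewrite -rmorphXn/= -[leLHS]/((1:int)%:~R) ler_int.
by rewrite -gtz0_ge1 lt_neqAle sqr_ge0 eq_sym sqrf_eq0 ki.
Qed.

Lemma sobolev_weight_ge1 k : 1 <= sobolev_weight k.
Proof.
rewrite /sobolev_weight; case: ifPn => // k0.
by rewrite -(powRr0 (enorm k)) ler_powR ?enorm_ge1 ?(ltW q0).
Qed.

Lemma enorm_powR2 k : k != freq0 -> enorm k `^ (2 * q) = sobolev_weight k ^+ 2.
Proof.
move=> k0; rewrite /sobolev_weight (negPf k0) mulrC powRrM.
by rewrite powR_mulrn ?powR_ge0.
Qed.

Lemma enorm_powRN2 k : k != freq0 -> enorm k `^ (2 * - q) = (sobolev_weight k ^+ 2)^-1.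
Proof. by move=> k0; rewrite mulrN powRN enorm_powR2. Qed.

Lemma negative_norm_fset_sums f : mean_zero f -> 0 < fine (Hnorm (- q) f) ->
  (forall F, \sum_(k <- F) (Normc.normc (fourier f k) / sobolev_weight k) ^+ 2
     <= fine (Hnorm (- q) f) ^+ 2) /\
  exists2 S : {fset K}, freq0 \notin S & fine (Hnorm (- q) f) ^+ 2 / 2 <=
     \sum_(k <- S) (Normc.normc (fourier f k) / sobolev_weight k) ^+ 2.
Proof.
move=> f0; set t := fun k => (Normc.normc (fourier f k) / sobolev_weight k) ^+ 2.
rewrite /Hnorm; set D := [set k | k != freq0].
have -> : (\esum_(k in D) (enorm k `^ (2 * - q) * Normc.normc (fourier f k) ^+ 2)%:E)%E =
          (\esum_(k in D) (t k)%:E)%E.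
  by apply: eq_esum => k /= k0; rewrite enorm_powRN2// /t expr_div_n mulrC.
set s := esum _ _; rewrite fine_poweR => s0.
have s_ge0 : (0 <= s)%E by apply: esum_ge0 => k _; rewrite lee_fin sqr_ge0.
have fs0 : 0 < fine s.
  rewrite lt_neqAle fine_ge0// andbT; apply/eqP => h.
  by move: s0; rewrite -h powR0// ltxx.
(* [fine] sends [+oo] to 0, so its positivity rules out an infinite sum. *)
have sfin : s \is a fin_num.
  by rewrite ge0_fin_numE// ltey; apply/eqP => h; move: fs0; rewrite h ltxx.
have -> : (fine s `^ 2^-1) ^+ 2 = fine s by rewrite powR12_sqrt ?sqr_sqrtr// ltW.
have t0 : t freq0 = 0.
  by rewrite /t f0 /Normc.normc/= expr0n/= addr0 sqrtr0 mul0r expr0n.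
split => [F|].
  (* The norm omits [freq0], and the zero mean makes the term there vanish, so [F] may be assumed to
     avoid it. *)
  have -> : \sum_(k <- F) t k = \sum_(k <- (F `\ freq0)%fset) t k.
    have [F0|F0] := boolP (freq0 \in F); first by rewrite (big_fsetD1 freq0)//= t0 add0r.
    congr (\sum_(k <- enum_fset _) _); apply/fsetP => k; rewrite !inE.
    by case: eqP => [->|//]; rewrite (negPf F0).
  rewrite -lee_fin fineK//; apply: fset_sum_le_esum => k /=.
  by rewrite !inE => /andP[].
have [S SD hS] : exists2 S : {fset K}, [set` S] `<=` D & fine s / 2 < \sum_(k <- S) t k.
  apply: esum_gt_fset_sum; rewrite -/s -[ltRHS]fineK// lte_fin; lra.
exists S; last exact: ltW.
by apply/negP => /SD /=; rewrite /D/= eqxx.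
Qed.

(** On a finite set carrying half of the squared norm, the real or the imaginary parts of the
    coefficients carry half again. Against real [gamma] that functional is one component of the
    pairing, hence bounded by its modulus. *)
Lemma real_functional f : mean_zero f -> 0 < fine (Hnorm (- q) f) ->
  exists phi : K -> R, [/\
    (forall F, \sum_(k <- F) (phi k / sobolev_weight k) ^+ 2 <= fine (Hnorm (- q) f) ^+ 2),
    (exists2 S : {fset K}, freq0 \notin S & fine (Hnorm (- q) f) ^+ 2 / 4 <=
       \sum_(k <- S) (phi k / sobolev_weight k) ^+ 2) &
    (forall g (gamma : K -> R), (forall k, fourier g k = (gamma k)%:C) ->
      `|rsum (fun k => phi k * gamma k)| <= Normc.normc (pairing f g))].
Proof.
move=> f0 L0; have [fL [S S0 fS]] := negative_norm_fset_sums f0 L0.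
set L := fine _ in L0 fL fS *.
have normE k : (Normc.normc (fourier f k) / sobolev_weight k) ^+ 2 =
    (complex.Re (fourier f k) / sobolev_weight k) ^+ 2 +
    (complex.Im (fourier f k) / sobolev_weight k) ^+ 2.
  case: (fourier f k) => a b; rewrite /Normc.normc/= !expr_div_n sqr_sqrtr ?mulrDl//.
  by rewrite addr_ge0// sqr_ge0.
have ReL F : \sum_(k <- F) (complex.Re (fourier f k) / sobolev_weight k) ^+ 2 <= L ^+ 2.
  apply: le_trans (fL F); apply: ler_sum => k _.
  by rewrite normE lerDl sqr_ge0.
have ImL F : \sum_(k <- F) (complex.Im (fourier f k) / sobolev_weight k) ^+ 2 <= L ^+ 2.
  apply: le_trans (fL F); apply: ler_sum => k _.
  by rewrite normE lerDr sqr_ge0.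
have pairE g (gamma : K -> R) : (forall k, fourier g k = (gamma k)%:C) ->
    pairing f g = rsum (fun k => complex.Re (fourier f k) * gamma k) +i*
                  rsum (fun k => complex.Im (fourier f k) * gamma k).
  move=> gE; rewrite /pairing /csum; congr (Complex _ _); congr rsum; apply/funext => k.
    by rewrite gE; case: (fourier f k) => x y /=; rewrite oppr0 mulr0 subr0.
  by rewrite gE; case: (fourier f k) => x y /=; rewrite oppr0 mulr0 add0r.
have normcE (x y : R) : `|x| <= Normc.normc (x +i* y) /\ `|y| <= Normc.normc (x +i* y).
  by rewrite /Normc.normc -!sqrtr_sqr; split; apply: ler_wsqrtr;
    rewrite ?lerDl ?lerDr sqr_ge0.
rewrite (eq_bigr _ (fun k _ => normE k)) in fS.
have [ReS|ImS] := leP (L ^+ 2 / 4)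
    (\sum_(k <- S) (complex.Re (fourier f k) / sobolev_weight k) ^+ 2).
  exists (fun k => complex.Re (fourier f k)); split=> //; first by exists S.
  by move=> g gamma /pairE ->; exact: (normcE _ _).1.
exists (fun k => complex.Im (fourier f k)); split=> //.
  by exists S => //=; move: fS; rewrite big_split/=; lra.
by move=> g gamma /pairE ->; exact: (normcE _ _).2.
Qed.

Lemma Hdot_of_coefficients f (gamma : K -> R) : L2_torus f ->
  (forall k, fourier f k = (gamma k)%:C) -> gamma freq0 = 0 ->
  (forall F, \sum_(k <- F) (sobolev_weight k * gamma k) ^+ 2 <= 3) -> Hdot q f.
Proof.
move=> fL2 fE g0 gF; split => //; first by rewrite /mean_zero fE g0.
apply: poweR_lty; apply: (@le_lt_trans _ _ 3%:E); last exact: ltry.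
apply: le_trans (esum_le_fset_sum (fun F _ => gF F)).
apply: le_esum => k k0; rewrite lee_fin fE enorm_powR2//=.
by rewrite expr0n/= addr0 sqr_sqrtr ?sqr_ge0// exprMn.
Qed.

End SobolevWeight.

(** * Choice of the times and lower bound for the limsup *)

Lemma limf_esup_gt0 (Y : choiceType) (X : filteredType Y) (R : realType)
    (u : X -> \bar R) (F : set (set X)) (e : R) :
  0 < e -> (forall V, F V -> exists2 x, V x & (e%:E <= u x)%E) -> (0 < limf_esup u F)%E.
Proof.
move=> e0 uF; apply: (@lt_le_trans _ _ e%:E); first by rewrite lte_fin.
apply/ereal_infP => _ [V FV <-]; have [x Vx ux] := uF V FV.
by apply: le_trans ux _; apply: ereal_sup_ubound; exists x.
Qed.

Lemma time_set_unbounded (R : realType) (T : set R) (M : R) :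
  T = [set t | 0 <= t] \/ T = [set n%:R | n in [set: nat]] -> exists2 t, T t & M < t.
Proof.
case=> ->.
  by exists (`|M| + 1); rewrite /= ?addr_ge0//; have := ler_norm M; lra.
exists (Num.bound `|M|)%:R; first by exists (Num.bound `|M|).
by apply: le_lt_trans (ler_norm M) _; exact: archi_boundP.
Qed.

Theorem theorem2 (R : realType) (d : nat) (T : set R) (q : R)
    (f : R -> Rvec R d -> R[i]) (h : R -> R) :
  (0 < d)%N ->
  T = [set t | 0 <= t] \/ T = [set n%:R | n in [set: nat]] ->
  0 < q ->
  (forall t, T t -> L2_torus (f t) /\ mean_zero (f t)) ->
  (forall t, T t -> 0 < t -> (0 < Hnorm (- q) (f t))%E) ->
  (forall t, T t -> 0 < h t) ->
  h =o_ (within T (+oo_ R)) (fun t => fine (Hnorm (- q) (f t))) ->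
  exists g : Rvec R d -> R[i],
    Hdot q g /\
    (0 < limf_esup (fun t => (Normc.normc (pairing (f t) g) / h t)%:E)
           (within T (+oo_ R)))%E.
Proof.
move=> _ TE q0 fL2 _ h0 hL.
pose L t := fine (Hnorm (- q) (f t)).
have /choice[s sP] (j : nat) : exists t, [/\ T t, j%:R < t & h t <= 8^-1 ^+ j * L t].
  have e0 : 0 < (8^-1 : R) ^+ j by rewrite exprn_gt0// invr_gt0.
  have [M [_ hM]] := (eqoP _ _ _).1 hL _ e0.
  (* [M] is the threshold of the little-o relation with constant [8^-1 ^+ j]; the maximum with [j]
     drives the times to infinity. *)
  have [t Tt Mt] := time_set_unbounded (Num.max M j%:R) TE.
  move: Mt; rewrite gt_max => /andP[Mt jt]; exists t; split=> //.
  have := hM t Mt Tt; rewrite gtr0_norm ?h0// ger0_norm//.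
  by rewrite fine_ge0// poweR_ge0.
have Ts j : T (s j) by have [] := sP j.
have Ls0 j : 0 < L (s j).
  (* Positivity of [h] forces that of [L] at the chosen times, since [h] is at most [8^-1 ^+ j * L]
     there. *)
  have [_ _ hj] := sP j; have := lt_le_trans (h0 _ (Ts j)) hj.
  by rewrite pmulr_rgt0// exprn_gt0// invr_gt0.
have /choice[phi phiP] j := real_functional (fL2 _ (Ts j)).2 (Ls0 j).
have phiL j : _ := let: And3 p _ _ := phiP j in p.
have /choice[S SP] j : exists S : {fset d.-tuple int}, freq0 \notin S /\
    L (s j) ^+ 2 / 4 <= \sum_(k <- S) (phi j k / sobolev_weight q k) ^+ 2.
  by have [_ [S S0 hS] _] := phiP j; exists S.
have w1 := @sobolev_weight_ge1 R d q q0.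
have w0 (k : d.-tuple int) : 0 < sobolev_weight q k.
  by apply: (lt_le_trans ltr01); exact: w1.
have [a [aS a1 aL]] := gliding_hump w1 Ls0 phiL (fun j => (SP j).2).
set gamma := fun k => limn (fun n => \sum_(0 <= i < n) 8^-1 ^+ i * a i k).
have gF := geometric_coefficient_sqr_le w1 a1.
have a1' i (F : {fset d.-tuple int}) : \sum_(k <- F) a i k ^+ 2 <= 1.
  apply: le_trans (a1 i F); apply: ler_sum => k _.
  by rewrite exprMn ler_peMl ?sqr_ge0// expr_ge1// ?w1// ltW.
have [g gL2 gE] := riesz_fischer aS a1'.
exists g; split.
  apply: (Hdot_of_coefficients gL2 gE) => //.
  (* All supports [S i] avoid [freq0], so the limit coefficient there is 0 and [g] has mean zero. *)
  rewrite (_ : (fun n => _) = cst 0) ?lim_cst//.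
  by apply/funext => n; rewrite big1// => i _; rewrite aS ?mulr0//; exact: (SP i).1.
apply: (limf_esup_gt0 (e := 4^-1)) => [|V [M [_ MV]]]; first by rewrite invr_gt0.
(* [M] is the threshold of the neighbourhood [V]; an index above [|M|] suffices because [s j]
   exceeds [j]. *)
pose j := Num.bound `|M|.
have Mj : M < s j.
  have [_ js _] := sP j; apply: le_lt_trans (ler_norm M) _; apply: lt_trans js.
  exact: archi_boundP.
exists (s j); first exact: MV.
rewrite lee_fin ler_pdivlMr ?h0//.
have [_ _ phi_pair] := phiP j; apply: le_trans (phi_pair g gamma gE).
have [F0 F0P] := aL j.
have [_ _ hs] := sP j.
apply: (@le_trans _ _ (8^-1 ^+ j * L (s j) / 4)); first by rewrite mulrC ler_wpM2r ?invr_ge0.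
(* The bound holds for finite sums over sets containing [F0]; one such sum lies within [e] of the
   full sum, and [e] is arbitrary. *)
apply/ler_addgt0Pr => e e0.
have [F F0F hF] := rsum_approx F0
  (fun F => weighted_cauchy_schwarz w0 (Ls0 j) (phiL j F) (gF F)) e0.
apply: le_trans (F0P F F0F) _.
move: hF; set r := rsum _; set t := \sum_(k <- F) _ => hF.
have -> : t = r - (r - t) by rewrite opprB addrC subrK.
by apply: le_trans (ler_normB _ _) _; rewrite lerD2l.
Qed.
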